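(* Let $n\ge 1$ be an integer. Then the polynomial $$\widetilde{C}_n(\mathbf{x},\mathbf{y})=\sum_{\sigma\in C_n}\ \prod_{i\in\widetilde{\mathcal{DT}}_C(\sigma)}x_i\prod_{i\in\widetilde{\mathcal{AT}}_C(\sigma)}y_i\ \in\ \mathbb{R}[x_1,\dots,x_n,y_1,\dots,y_n]$$ is stable.
   Context: A polynomial $f\in\mathbb{R}[z_1,\dots,z_m]$ is called (real) stable if $f\equiv 0$ or $f(z_1,\dots,z_m)\ne 0$ whenever all $z_j\in\mathbb{C}$ have strictly positive imaginary part. $C_n$ (the Coxeter group of type $C$ and rank $n$, equal to that of type $B$) is the group of signed permutations, i.e. the set of sequences $\sigma=(\sigma_1,\dots,\sigma_n)$ of nonzero integers such that $(|\sigma_1|,\dots,|\sigma_n|)$ is a permutation of $\{1,\dots,n\}$. Put $\sigma_0=0$ and $$\mathcal{DT}_B(\sigma)=\{\max(|\sigma_i|,|\sigma_{i+1}|):0\le i\le n-1,\ \sigma_i>\sigma_{i+1}\},$$ $$\mathcal{AT}_B(\sigma)=\{\max(|\sigma_i|,|\sigma_{i+1}|):0\le i\le n-1,\ \sigma_i<\sigma_{i+1}\}.$$ Let $\widetilde{\mathcal{DT}}_C(\sigma)=\mathcal{DT}_B(\sigma)\cup\{|\sigma_n|\}$ if $\sigma_n>0$, and $\widetilde{\mathcal{DT}}_C(\sigma)=\mathcal{DT}_B(\sigma)$ otherwise. Let $\widetilde{\mathcal{AT}}_C(\sigma)=\mathcal{AT}_B(\sigma)\cup\{|\sigma_n|\}$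 if $\sigma_n<0$, and $\widetilde{\mathcal{AT}}_C(\sigma)=\mathcal{AT}_B(\sigma)$ otherwise. *)

(* Defs.v *)
From HB Require Import structures.
From mathcomp Require Import all_boot all_order all_fingroup all_algebra.
From mathcomp Require Import complex.
From mathcomp Require Import mpoly.
From mathcomp Require Import reals.

Set Implicit Arguments.
Unset Strict Implicit.
Unset Printing Implicit Defensive.

Import Order.TTheory GRing.Theory Num.Theory.
Local Open Scope ring_scope.

Definition stable (R : realType) (m : nat) (p : {mpoly R[m]}) : Prop :=
  p = 0 \/
  forall z : 'I_m -> R[i], (forall j, 0 < complex.Im (z j)) ->
    (map_mpoly (real_complex R) p).@[z] <> 0.

(* A signed permutation is stored as its underlying permutation together with
   the positions carrying a minus sign. Everything is 0-based: the position
   [i : 'I_n] stands for i + 1, and so does the value [i : 'I_n]. *)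
Definition signed_perm (n : nat) : finType :=
  ('S_n * {ffun 'I_n -> bool})%type.

(* The one-line notation sigma_1, ..., sigma_n. *)
Definition entry (n : nat) (s : signed_perm n) (i : 'I_n) : int :=
  (-1) ^+ s.2 i * (s.1 i).+1%:Z.

(* sigma_j for a 1-based index j <= n, with sigma_0 = 0; the value for j > n
   is junk and is never used. *)
Definition letter (n : nat) (s : signed_perm n) (j : nat) : int :=
  if j is i.+1 then oapp (entry s) 0 (insub i) else 0.

(* Sets of values in {1, ..., n} are sets of ordinals, [k] standing for k + 1. *)
Definition DTB (n : nat) (s : signed_perm n) : {set 'I_n} :=
  [set k : 'I_n | [exists i : 'I_n,
     (letter s i > letter s i.+1) &&
     (k.+1 == maxn `|letter s i|%N `|letter s i.+1|%N)]].

Definition ATB (n : nat) (s : signed_perm n) : {set 'I_n} :=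
  [set k : 'I_n | [exists i : 'I_n,
     (letter s i < letter s i.+1) &&
     (k.+1 == maxn `|letter s i|%N `|letter s i.+1|%N)]].

Definition last_value (n : nat) (s : signed_perm n) : {set 'I_n} :=
  [set k : 'I_n | k.+1 == `|letter s n|%N].

Definition DTC (n : nat) (s : signed_perm n) : {set 'I_n} :=
  if 0 < letter s n then DTB s :|: last_value s else DTB s.

Definition ATC (n : nat) (s : signed_perm n) : {set 'I_n} :=
  if letter s n < 0 then ATB s :|: last_value s else ATB s.

(* Among the n + n variables, the first n are x_1, ..., x_n and the last n are
   y_1, ..., y_n. *)
Definition Ctilde (R : realType) (n : nat) : {mpoly R[n + n]} :=
  \sum_(s : signed_perm n)
    (\prod_(i in DTC s) 'X_(lshift n i)) * (\prod_(i in ATC s) 'X_(rshift n i)).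

(* [entry] identifies [signed_perm n] with the sequences of nonzero integers
   whose absolute values form a permutation of {1, ..., n}. *)
Lemma entry_inj (n : nat) (s t : signed_perm n) : entry s =1 entry t -> s = t.
Proof.
case: s t => [p e] [q f] E.
have absE i : (p i).+1 = (q i).+1.
  have := congr1 absz (E i).
  by rewrite /entry /= !abszM !abszX !exp1n !mul1n.
congr pair; first by apply/permP=> i; apply/val_inj; case: (absE i).
apply/ffunP=> i; have := E i; rewrite /entry /= (absE i).
by case: (e i); case: (f i); rewrite ?expr0 ?expr1 ?mul1r ?mulN1r.
Qed.

Lemma entryP (n : nat) (w : 'I_n -> int) :
  (exists s : signed_perm n, entry s =1 w) <->
  perm_eq [seq `|w i|%N | i : 'I_n] (iota 1 n).
Proof.
have iotaE : iota 1 n = [seq (val i).+1 | i : 'I_n].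
  by rewrite (iotaDl 1 0 n) -val_enum_ord -map_comp; apply: eq_map.
split=> [[s sw]|].
  rewrite iotaE.
  have -> : [seq `|w i|%N | i : 'I_n]
            = [seq (val i).+1 | i <- [seq s.1 i | i : 'I_n]].
    rewrite -map_comp; apply: eq_map => i /=.
    by rewrite -sw /entry abszM abszX exp1n mul1n.
  apply: perm_map; apply: uniq_perm; rewrite ?enum_uniq //.
    by rewrite map_inj_uniq ?enum_uniq //; exact: perm_inj.
  move=> i; rewrite mem_enum; apply/mapP.
  by exists ((s.1^-1)%g i); rewrite ?mem_enum ?permKV.
move=> pw.
have w_in i : `|w i|%N \in iota 1 n.
  by rewrite -(perm_mem pw); apply: image_f.
have lt_w i : (`|w i|.-1 < n)%N.
  by have := w_in i; rewrite mem_iota add1n ltnS; case: `|w i|%N.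
have w_gt0 i : (0 < `|w i|)%N by have := w_in i; rewrite mem_iota; case/andP.
pose g i := Ordinal (lt_w i).
have g_inj : injective g.
  move=> i j /(congr1 val) /= eij.
  have : uniq [seq `|w i|%N | i : 'I_n] by rewrite (perm_uniq pw) iota_uniq.
  move/injectiveP; apply.
  by rewrite -(prednK (w_gt0 i)) eij prednK.
exists (perm g_inj, [ffun i => w i < 0]) => i.
by rewrite /entry /= permE ffunE /= prednK // abszE -intEsign.
Qed.

(* Main.v *)
Require Import Defs.
From HB Require Import structures.
From mathcomp Require Import all_boot all_order all_fingroup all_algebra.
From mathcomp Require Import complex mpoly reals.
From mathcomp Require Import zify.

(** View sigma as the cyclic word 0 sigma_1 ... sigma_n 0, each of whose n + 1
gaps carries the variable x_k (descent) or y_k (ascent), k being the larger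
absolute value around the gap; the monomial of sigma is the product over its
gaps. The words of rank n + 1 arise by inserting n + 1 or - (n + 1) into a gap
of a word of rank n, which replaces the variable of that gap by
x_(n + 1) y_(n + 1). Hence C_(n + 1) = 2 x_(n + 1) y_(n + 1) D C_n, where D is
the sum of all partial derivatives. On the line z + t (1, ..., 1) the operator
D is d/dt, and t |-> C_n (z + t (1, ..., 1)) has positive degree and no root
with Im t >= 0, so by Gauss-Lucas its derivative does not vanish at t = 0. *)

Set Implicit Arguments.
Unset Strict Implicit.
Unset Printing Implicit Defensive.

Import Order.TTheory GRing.Theory Num.Theory.
Local Open Scope ring_scope.

(** * A half-plane form of the Gauss-Lucas theorem *)

Section HalfPlane.

Variable R : rcfType.
Implicit Types (x y : R[i]) (p : {poly R[i]}).

Lemma ImD x y : complex.Im (x + y) = complex.Im x + complex.Im y.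
Proof. by case: x y => [a b] [c d]. Qed.

(** Negation moves [x] to the upper half-plane, and inversion moves it back to the lower one. *)
Lemma Im_invN_lt0 x : complex.Im x < 0 -> complex.Im (- x)^-1 < 0.
Proof.
case: x => a b /= b_lt0.
have ab_gt0 : 0 < (- a) ^+ 2 + (- b) ^+ 2.
  by rewrite ltr_wpDl ?sqr_ge0 // exprn_gt0 // oppr_gt0.
by rewrite oppr_lt0 divr_gt0 ?oppr_gt0.
Qed.

Lemma Im_sum_invN_lt0 (rs : seq R[i]) :
  all (fun r => complex.Im r < 0) rs -> rs != [::] ->
  complex.Im (\sum_(r <- rs) (- r)^-1) < 0.
Proof.
elim: rs => // r [|r' rs] IH /andP[r_lt0 rs_lt0] _.
  by rewrite big_seq1 Im_invN_lt0.
rewrite big_cons ImD -[ltRHS]addr0 ltrD ?Im_invN_lt0 //.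
exact: IH.
Qed.

(** This is the logarithmic derivative, the sum of 1 / (t - r) over the roots, taken at t = 0. *)
Lemma deriv_prod_XsubC0 (rs : seq R[i]) : 0 \notin rs ->
  let q := \prod_(r <- rs) ('X - r%:P) in
  q^`().[0] = q.[0] * \sum_(r <- rs) (- r)^-1.
Proof.
elim: rs => [|r rs IH] /=; first by rewrite !big_nil derivC hornerC mulr0.
rewrite inE negb_or eq_sym => /andP[r_neq0 /IH {}IH].
rewrite !big_cons derivM derivXsubC mul1r hornerD !hornerM IH.
rewrite hornerXsubC sub0r mulrDr; congr (_ + _); last by rewrite mulrA.
by rewrite mulrAC mulfV ?mul1r // oppr_eq0.
Qed.

(** All roots lie in the open lower half-plane, and the degree provides at least one, so the
    logarithmic derivative at 0 has negative imaginary part. *)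
Lemma deriv0_neq0 p : (1 < size p)%N ->
  (forall t, 0 <= complex.Im t -> p.[t] != 0) -> p^`().[0] != 0.
Proof.
move=> p_gt1 p_neq0; have [rs def_p] := closed_field_poly_normal p.
have lp_neq0 : lead_coef p != 0.
  by rewrite lead_coef_eq0 -size_poly_gt0 ltnW.
have rs_lt0 : all (fun r => complex.Im r < 0) rs.
  apply/allP=> r rs_r; rewrite ltNge; apply/negP=> /p_neq0.
  by rewrite -rootE def_p rootZ // root_prod_XsubC rs_r.
have rs_neq0 : rs != [::].
  apply: contraTneq p_gt1 => rs0.
  by rewrite def_p rs0 big_nil alg_polyC size_polyC lp_neq0.
have rs_0 : 0 \notin rs by apply/negP => /(allP rs_lt0); rewrite ltxx.
have := p_neq0 0 (lexx _); rewrite {1}def_p hornerZ => lq_neq0.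
rewrite def_p derivZ hornerZ deriv_prod_XsubC0 // mulrA mulf_neq0 //.
by have := Im_sum_invN_lt0 rs_lt0 rs_neq0; apply: contraTneq => ->; rewrite ltxx.
Qed.

End HalfPlane.

(** * Products of monic linear factors *)

Section LinearFactors.

Variable K : comNzRingType.
Implicit Type s : seq K.

(** The Leibniz rule omits one factor at a time, in the same form as an insertion does in
    [prod_gaps_ins]. *)
Lemma deriv_prod_XaddC0 s :
  (\prod_(c <- s) ('X + c%:P))^`().[0] =
  \sum_(i < size s) \prod_(c <- take i s ++ drop i.+1 s) c.
Proof.
have horner0 s' : (\prod_(c <- s') ('X + c%:P)).[0] = \prod_(c <- s') c.
  rewrite horner_prod; apply: eq_bigr => c _.
  by rewrite hornerD hornerX hornerC add0r.
elim: s => [|c s IH]; first by rewrite !big_nil big_ord0 derivC hornerC.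
rewrite big_cons derivM derivD derivX derivC addr0 mul1r big_ord_recl /=.
rewrite hornerD hornerM IH horner0 drop0 hornerD hornerX hornerC add0r.
by rewrite mulr_sumr; congr (_ + _); apply: eq_bigr => i _; rewrite big_cons.
Qed.

Lemma coef_prod_XaddC s : (\prod_(c <- s) ('X + c%:P))`_(size s) = 1.
Proof.
have -> : \prod_(c <- s) ('X + c%:P) =
          \prod_(c <- [seq - c | c <- s]) ('X - c%:P).
  by rewrite big_map; apply: eq_bigr => c _; rewrite polyCN opprK.
have := monic_prod_XsubC [seq - c | c <- s] predT id.
by move/monicP; rewrite lead_coefE size_prod_XsubC size_map.
Qed.

End LinearFactors.

(** * Gaps of a word and insertion of a letter *)

Section Gaps.

Variable K : comNzRingType.
Implicit Types (z : bool -> nat -> K) (w l : seq int).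

(* [z true] holds the x-variables and [z false] the y-variables. *)
Definition gap z (a b : int) : K := z (b < a) (maxn `|a| `|b|)%N.

(** The closing 0 makes the last gap a descent after a positive letter and an ascent after a
    negative one, which is how [DTC] and [ATC] extend [DTB] and [ATB]. *)
Definition gaps z w : seq K := pairmap (gap z) 0 (rcons w 0).

Lemma size_gaps z w : size (gaps z w) = (size w).+1.
Proof. by rewrite size_pairmap size_rcons. Qed.

Lemma gaps_shift z t w :
  gaps (fun d k => z d k + t) w = [seq c + t | c <- gaps z w].
Proof.
rewrite /gaps; move: (rcons w 0) => l.
by elim: l 0 => //= b l IH a; rewrite IH.
Qed.

Definition ins w (p : nat * int) : seq int := take p.1 w ++ p.2 :: drop p.1 w.

(** The new letter dominates in absolute value, so both gaps beside it have index [|a|]. Whatever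
    the sign of [a], one of them is an ascent and the other a descent. *)
Lemma prod_gaps_ins z w i a : (i <= size w)%N ->
  (forall b, b \in w -> (`|b| < `|a|)%N) -> (0 < `|a|)%N ->
  \prod_(c <- gaps z (ins w (i, a))) c =
  z true `|a|%N * z false `|a|%N *
  \prod_(c <- take i (gaps z w) ++ drop i.+1 (gaps z w)) c.
Proof.
rewrite /gaps /ins /= => le_iw lt_wa a_gt0.
have {lt_wa} lt_la b : b \in 0 :: rcons w 0 -> (`|b| < `|a|)%N.
  by rewrite inE mem_rcons inE => /or3P[/eqP->|/eqP->|/lt_wa].
rewrite rcons_cat /=.
have -> : rcons w 0 = take i w ++ rcons (drop i w) 0.
  by rewrite -rcons_cat cat_take_drop.
have {le_iw} : size (take i w) = i by rewrite size_takel.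
have {lt_la} : forall b, b \in 0 :: (take i w ++ rcons (drop i w) 0) ->
    (`|b| < `|a|)%N.
  by rewrite -rcons_cat cat_take_drop.
move: (take i w) => u.
(* The closing 0 keeps the right part nonempty; [b] is the right neighbour of the inserted letter,
   possibly that 0. *)
case: (rcons (drop i w) 0) (size_rcons (drop i w) 0) => // b l _ lt_la size_u.
rewrite !pairmap_cat /= take_size_cat ?size_pairmap //.
rewrite drop_cat size_pairmap size_u ltnNge leqnSn /= subSnn /= drop0.
rewrite !big_cat !big_cons /= [RHS]mulrCA.
set c := last 0 u; rewrite [X in _ * X]mulrA; congr (_ * (_ * _)).
have lt_ca : (`|c| < `|a|)%N.
  apply: lt_la; have := mem_last 0 u; rewrite !inE mem_cat => /orP[->|->] //.
  by rewrite orbT.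
have lt_ba : (`|b| < `|a|)%N by apply: lt_la; rewrite inE mem_cat mem_head !orbT.
rewrite /gap (maxn_idPr (ltnW lt_ca)) (maxn_idPl (ltnW lt_ba)).
have -> : (b < a) = ~~ (a < c) by lia.
by case: (a < c); rewrite //= mulrC.
Qed.

End Gaps.

(** * Words built by successive insertions *)

Fixpoint words (n : nat) : seq (seq int) :=
  if n is m.+1 then
    [seq ins w p | w <- words m,
       p <- [seq (i, a) | i <- iota 0 m.+1, a <- [:: m.+1%:Z; - m.+1%:Z]]]
  else [:: [::]].

Lemma wordsS n : words n.+1 =
  [seq ins w p | w <- words n,
     p <- [seq (i, a) | i <- iota 0 n.+1, a <- [:: n.+1%:Z; - n.+1%:Z]]].
Proof. by []. Qed.

Lemma wordsSP n w : reflect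
  (exists v i a, [/\ v \in words n, (i <= n)%N, `|a|%N = n.+1 & w = ins v (i, a)])
  (w \in words n.+1).
Proof.
apply: (iffP allpairsP) => [[[v p] [v_in /allpairsP[[i a] [i_in a_in def_p]] ->]]|].
  rewrite [p]def_p; exists v, i, a; split=> //; first by rewrite mem_iota in i_in.
  by move: a_in; rewrite !inE => /orP[] /eqP /= ->; rewrite ?abszN.
case=> v [i [a [v_in le_in a_abs ->]]]; exists (v, (i, a)); split=> //.
apply: allpairs_f; first by rewrite mem_iota.
by rewrite !inE; lia.
Qed.

Lemma words_size n w : w \in words n -> size w = n.
Proof.
elim: n w => [|n IH] w; first by rewrite inE => /eqP->.
case/wordsSP=> v [i [a [/IH size_v le_in _ ->]]].
by rewrite size_cat /= size_takel ?size_v // size_drop size_v addnS subnKC.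
Qed.

Lemma words_le n w a : w \in words n -> a \in w -> (`|a| <= n)%N.
Proof.
elim: n w => [|n IH] w; first by rewrite inE => /eqP->.
case/wordsSP=> v [i [b [/IH v_le le_in b_abs ->]]].
rewrite mem_cat inE => /or3P[/mem_take/v_le/leqW //|/eqP->|/mem_drop/v_le/leqW //].
by rewrite b_abs.
Qed.

Lemma size_words n : size (words n) = (n`! * 2 ^ n)%N.
Proof.
elim: n => // n IH; rewrite wordsS size_allpairs IH size_allpairs size_iota.
by rewrite factS expnS /=; lia.
Qed.

(** Deleting the letter of absolute value [n.+1] leaves a word covered by induction. *)
Lemma mem_words n w : perm_eq (map absz w) (iota 1 n) -> w \in words n.
Proof.
elim: n w => [|n IH] w pw.
  by rewrite inE -size_eq0 -(size_map absz) (perm_size pw).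
have /mapP[a w_a a_abs] : n.+1 \in map absz w.
  by rewrite (perm_mem pw) mem_iota add1n !ltnS leqnn.
case/path.splitPr: w_a pw => u v pw.
have puv : perm_eq (map absz (u ++ v)) (iota 1 n).
  rewrite -(perm_cons n.+1) {1}a_abs -map_cons.
  apply: (@perm_trans _ (map absz (u ++ a :: v))).
    by apply: perm_map; rewrite perm_sym -[a :: v]cat1s perm_catCA perm_refl.
  apply: (perm_trans pw).
  have -> : iota 1 n.+1 = rcons (iota 1 n) n.+1 by rewrite -(addn1 n) iotaD cats1 addn1.
  by rewrite perm_rcons.
apply/wordsSP; exists (u ++ v), (size u), a; split=> //; first exact: IH.
  have := perm_size puv; rewrite size_map size_iota size_cat => <-.
  exact: leq_addr.
by rewrite /ins /= take_size_cat // drop_size_cat.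
Qed.

(** * The differential recursion and nonvanishing *)

Section Recursion.

Variable K : comNzRingType.
Implicit Type z : bool -> nat -> K.

Definition words_sum z n : K := \sum_(w <- words n) \prod_(c <- gaps z w) c.

Definition words_line z n : {poly K} :=
  \sum_(w <- words n) \prod_(c <- gaps z w) ('X + c%:P).

Lemma horner_words_line z n t :
  (words_line z n).[t] = words_sum (fun d k => z d k + t) n.
Proof.
rewrite horner_sum; apply: eq_bigr => w _.
rewrite gaps_shift big_map horner_prod; apply: eq_bigr => c _.
by rewrite hornerD hornerX hornerC addrC.
Qed.

(** Each term of the derivative omits one gap, the place of an insertion; the factor 2 counts the
    two signs of the new letter. *)
Lemma words_sumS z n :
  words_sum z n.+1 = (words_line z n)^`().[0] * (z true n.+1 * z false n.+1) *+ 2.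
Proof.
rewrite /words_sum /words_line raddf_sum horner_sum.
rewrite mulr_suml -sumrMnl wordsS big_allpairs_dep.
rewrite big_seq [RHS]big_seq; apply: eq_bigr => w w_in.
rewrite deriv_prod_XaddC0 size_gaps (words_size w_in) mulr_suml -sumrMnl.
rewrite big_allpairs -/(index_iota 0 n.+1) big_mkord; apply: eq_bigr => i _.
rewrite !big_cons big_nil /= addr0 mulr2n.
have le_iw : (i <= size w)%N by rewrite (words_size w_in) -ltnS.
by rewrite !prod_gaps_ins ?abszN //= => [|b /(words_le w_in)|b /(words_le w_in)] //;
  rewrite mulrC.
Qed.

End Recursion.

(** Every summand is monic of degree [n.+1], so the coefficient in that degree is the number of
    words, which is nonzero in characteristic 0. *)
Lemma size_words_line (K : numDomainType) (z : bool -> nat -> K) n :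
  (n.+1 < size (words_line z n))%N.
Proof.
rewrite ltnNge; apply/negP=> /leq_sizeP/(_ _ (leqnn _))/eqP; apply/negP.
rewrite coef_sum big_seq (eq_bigr (fun=> 1)) => [|w w_in].
  rewrite -big_seq big_const_seq count_predT size_words iter_addr_0 pnatr_eq0.
  by rewrite -lt0n muln_gt0 fact_gt0 expn_gt0.
by have := coef_prod_XaddC (gaps z w); rewrite size_gaps (words_size w_in).
Qed.

Lemma words_sum_neq0 (R : rcfType) n (z : bool -> nat -> R[i]) :
  (forall d k, 0 < complex.Im (z d k)) -> words_sum z n != 0.
Proof.
have Im_neq0 (x : R[i]) : 0 < complex.Im x -> x != 0.
  by apply: contraTneq => ->; rewrite ltxx.
(* The empty word has one gap, which carries the extra variable [z false 0]. *)
elim: n z => [|n IH] z z_gt0.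
  by rewrite /words_sum /= big_seq1 /gaps /= big_seq1; apply/Im_neq0/z_gt0.
have xy_neq0 : z true n.+1 * z false n.+1 != 0.
  by rewrite mulf_neq0 ?Im_neq0.
rewrite words_sumS mulrn_eq0 /= mulf_neq0 //.
apply: deriv0_neq0; first exact: leq_ltn_trans (size_words_line z n).
move=> t t_ge0; rewrite horner_words_line; apply: IH => d k.
by rewrite ImD ltr_wpDr.
Qed.

(** * Signed permutations as words *)

Section SignedPermutations.

Variable n : nat.
Implicit Type s : signed_perm n.

Definition word s : seq int := [seq entry s i | i <- enum 'I_n].

Lemma size_word s : size (word s) = n.
Proof. by rewrite size_map size_enum_ord. Qed.

Lemma word_inj : injective word.
Proof.
by move=> s t /eq_in_map E; apply: entry_inj => i; apply: E; rewrite mem_enum.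
Qed.

(** By counting: [word] is injective into [words n], and both sides have n! 2^n entries. This also
    shows that no word is generated twice. *)
Lemma perm_word_words : perm_eq [seq word s | s : signed_perm n] (words n).
Proof.
have uniq_word : uniq [seq word s | s : signed_perm n].
  by rewrite map_inj_uniq ?enum_uniq //; apply: word_inj.
have sub_word : {subset [seq word s | s : signed_perm n] <= words n}.
  move=> _ /mapP[s _ ->]; apply: mem_words; rewrite -map_comp.
  by apply/(@entryP n (entry s)); exists s.
have size_word_words : (size (words n) <= size [seq word s | s : signed_perm n])%N.
  rewrite size_map -cardE card_prod card_Sn card_ffun card_bool card_ord.
  by rewrite size_words.
have [_ eq_mem] := uniq_min_size uniq_word sub_word size_word_words.
by apply: uniq_perm => //; exact: leq_size_uniq sub_word size_word_words.
Qed.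

Lemma letter_word s j : letter s j = nth 0 (0 :: word s) j.
Proof.
case: j => //= i; case: insubP => /= [k lt_in <-|].
  by rewrite (nth_map k) ?size_enum_ord // nth_ord_enum.
by rewrite -leqNgt => le_ni; rewrite nth_default ?size_word.
Qed.

Lemma gaps_word (K : comNzRingType) (z : bool -> nat -> K) s :
  gaps z (word s) =
  [seq gap z (letter s j) (letter s j.+1) | j <- iota 0 n.+1].
Proof.
apply: (@eq_from_nth _ 0) => [|j].
  by rewrite size_gaps size_word size_map size_iota.
rewrite size_gaps size_word => lt_jn.
rewrite (nth_map 0%N) ?size_iota // nth_iota // add0n.
rewrite (nth_pairmap 0) ?size_rcons ?size_word // !letter_word.
(* The closing 0 coincides with the default value of [nth], hence with [letter s n.+1]. *)
have nth_rcons0 i : nth 0 (rcons (word s) 0) i = nth 0 (word s) i.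
  by rewrite nth_rcons; case: ltngtP => // [lt|->]; rewrite nth_default // ltnW.
by rewrite -rcons_cons; case: j lt_jn => [|j] _ /=; rewrite !nth_rcons0.
Qed.

Lemma abs_letterS s j (lt_jn : (j < n)%N) :
  `|letter s j.+1|%N = (s.1 (Ordinal lt_jn)).+1.
Proof. by rewrite /= insubT /= /entry abszM abszX exp1n mul1n. Qed.

Lemma letter_out s j : (n < j)%N -> letter s j = 0.
Proof. by move=> lt_nj; rewrite letter_word nth_default //= size_word. Qed.

Lemma abs_letter_le s j : (`|letter s j| <= n)%N.
Proof.
case: j => // j; case: (ltnP j n) => [lt_jn|?]; last by rewrite letter_out.
by rewrite abs_letterS.
Qed.

Lemma letter_neq0 s j : (0 < j <= n)%N -> letter s j != 0.
Proof. by case: j => //= j lt_jn; rewrite -absz_gt0 (abs_letterS s lt_jn). Qed.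

Lemma abs_letter_inj s i j :
  letter s i != 0 -> `|letter s i|%N = `|letter s j|%N -> i = j.
Proof.
case: i j => [|i] [|j] //.
  by move=> nz /eqP; rewrite absz_eq0 (negPf nz).
case: (ltnP i n) => [lt_in _|le_ni]; last by rewrite letter_out ?eqxx.
case: (ltnP j n) => [lt_jn|le_nj]; last first.
  by rewrite [letter s j.+1]letter_out // abs_letterS.
by rewrite !abs_letterS => -[] /val_inj/perm_inj/(congr1 val) /= ->.
Qed.

Hypothesis n_gt0 : (0 < n)%N.

(** Equal neighbours would both be 0, but one of the positions [j], [j.+1] lies between 1 and [n]
    because [n] is positive. *)
Lemma letter_adj s j : (j <= n)%N -> letter s j != letter s j.+1.
Proof.
move=> le_jn; apply/eqP=> eq_j.
have [j0|/abs_letter_inj neq] := eqVneq (letter s j) 0; last first.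
  by have := neq _ (congr1 absz eq_j); lia.
suff [k k_in] : exists2 k, (0 < k <= n)%N & letter s k = 0.
  by apply/eqP; exact: letter_neq0.
case: j => [|j] in le_jn eq_j j0 *; first by exists 1%N; rewrite // -eq_j.
by exists j.+1.
Qed.

Definition top s (j : nat) : nat := maxn `|letter s j| `|letter s j.+1|.

Lemma top_bound s j : (j <= n)%N -> (0 < top s j <= n)%N.
Proof.
move=> le_jn; rewrite /top geq_max !abs_letter_le !andbT.
by have := letter_adj s le_jn; lia.
Qed.

(** Equal tops come from one letter shared by the two gaps, so [j = i.+1]. That letter dominates
    both its neighbours, so one gap is an ascent and the other a descent. *)
Lemma top_lt_inj s (i j : nat) : (i < j <= n)%N ->
  (letter s i.+1 < letter s i) = (letter s j.+1 < letter s j) ->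
  top s i <> top s j.
Proof.
case/andP=> lt_ij le_jn same eq_top.
have /andP[top_gt0 _] := top_bound s le_jn.
have topP k : exists2 p, (p == k) || (p == k.+1) & `|letter s p|%N = top s k.
  rewrite /top; case: (leqP `|letter s k| `|letter s k.+1|) => _.
    by exists k.+1; rewrite ?eqxx ?orbT.
  by exists k; rewrite ?eqxx.
have [p p_i p_top] := topP i; have [q q_j q_top] := topP j.
have eq_pq : p = q.
  apply: (@abs_letter_inj s); last by rewrite p_top q_top.
  by rewrite -absz_gt0 p_top eq_top.
have j_def : j = i.+1 by lia.
have {p_i q_j} p_def : p = i.+1 by lia.
have le_in : (i <= n)%N := ltnW (leq_trans lt_ij le_jn).
have := letter_adj s le_jn; have := letter_adj s le_in.
move: same eq_top p_top; rewrite /top p_def j_def.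
move: (letter s i) (letter s i.+1) (letter s i.+2) => a b c.
by lia.
Qed.

End SignedPermutations.

(** * The statistics as sets of tops of gaps *)

Section Statistics.

Variables (n : nat) (s : signed_perm n.+1).

Definition descent (j : 'I_n.+2) : bool := letter s j.+1 < letter s j.

Definition top_ord (j : 'I_n.+2) : 'I_n.+1 := inord (top s j).-1.

Lemma top_ordE j : (top_ord j).+1 = top s j.
Proof.
have /andP[top_gt0 top_le] := @top_bound _ (ltn0Sn n) s j (ltn_ord j).
by rewrite inordK prednK.
Qed.

Lemma top_ord_inj d : {in [set j | descent j == d] &, injective top_ord}.
Proof.
have neq_top (i j : 'I_n.+2) : (i < j)%N -> descent i = descent j ->
    top_ord i <> top_ord j.
  move=> lt_ij same /(congr1 (fun k : 'I__ => k.+1)); rewrite !top_ordE.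
  by apply: top_lt_inj => //; rewrite lt_ij -ltnS ltn_ord.
move=> i j; rewrite !inE => /eqP d_i /eqP d_j eq_top; apply: val_inj.
by case: (ltngtP i j) => // /neq_top; rewrite d_i d_j eq_top => /(_ erefl).
Qed.

Lemma mem_top_ord_imset d (k : 'I_n.+1) : reflect
  (exists2 j : 'I_n.+2, descent j = d & k.+1 = top s j)
  (k \in top_ord @: [set j | descent j == d]).
Proof.
apply: (iffP imsetP) => [[j]|[j dj k_top]].
  by rewrite inE => /eqP dj ->; exists j; rewrite ?top_ordE.
exists j; first by rewrite inE dj.
by apply: val_inj; have := top_ordE j; rewrite -k_top => -[].
Qed.

Lemma top_ord_imset d :
  let B := [set k : 'I_n.+1 | [exists i : 'I_n.+1,
    ((letter s i.+1 < letter s i) == d) && (k.+1 == top s i)]] in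
  (if (0 < letter s n.+1) == d then B :|: last_value s else B) =
  top_ord @: [set j | descent j == d].
Proof.
move=> B; apply/setP => k.
have out0 : letter s n.+2 = 0 by apply: letter_out.
have top_last : top s n.+1 = `|letter s n.+1|%N by rewrite /top out0 maxn0.
have B_top_ord : k \in B -> k \in top_ord @: [set j | descent j == d].
  rewrite inE => /existsP[i /andP[/eqP di /eqP k_top]]; apply/mem_top_ord_imset.
  by exists (widen_ord (leqnSn _) i).
apply/idP/idP=> [|/mem_top_ord_imset[j dj k_top]].
  case: eqP => // d_last; rewrite inE => /orP[//|].
  rewrite inE -top_last => /eqP k_top; apply/mem_top_ord_imset.
  by exists ord_max => //; rewrite -d_last -out0.
have [lt_jn|le_nj] := ltnP j n.+1.
  suff k_B : k \in B by case: ifP => _ //; rewrite inE k_B.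
  rewrite inE; apply/existsP; exists (Ordinal lt_jn).
  by rewrite -dj /descent k_top /= !eqxx.
have j_last : j = n.+1 :> nat by have := ltn_ord j; lia.
move: dj k_top; rewrite /descent j_last out0 top_last => -> k_top.
by rewrite eqxx !inE k_top eqxx orbT.
Qed.

Lemma DTC_top_ord : DTC s = top_ord @: [set j | descent j == true].
Proof.
rewrite -top_ord_imset eqb_id /DTC; suff -> : DTB s = [set k : 'I_n.+1 |
  [exists i : 'I_n.+1,
     ((letter s i.+1 < letter s i) == true) && (k.+1 == top s i)]] by [].
by apply/setP=> k; rewrite !inE; apply: eq_existsb => i; rewrite eqb_id.
Qed.

Lemma ATC_top_ord : ATC s = top_ord @: [set j | descent j == false].
Proof.
have lt_adj (j : nat) : (j <= n.+1)%N ->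
    ((letter s j.+1 < letter s j) == false) = (letter s j < letter s j.+1).
  by move=> le_jn; have := letter_adj (ltn0Sn n) s le_jn; lia.
(* Writing 0 as the letter after the last one lets [lt_adj] apply to the closing gap. *)
rewrite -top_ord_imset /ATC -[X in X < letter s n.+1](@letter_out _ s n.+2) // lt_adj //.
rewrite [letter s n.+2]letter_out //; suff -> : ATB s = [set k : 'I_n.+1 |
  [exists i : 'I_n.+1,
     ((letter s i.+1 < letter s i) == false) && (k.+1 == top s i)]] by [].
apply/setP=> k; rewrite !inE; apply: eq_existsb => i.
by rewrite lt_adj // ltnW.
Qed.

(** Within each class of gaps the tops are distinct, so a product over a set of values is a product
    over gaps. *)
Lemma prod_statistics (K : comNzRingType) (z : bool -> nat -> K) :
  (\prod_(i in DTC s) z true i.+1) * (\prod_(i in ATC s) z false i.+1) =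
  \prod_(c <- gaps z (word s)) c.
Proof.
rewrite DTC_top_ord ATC_top_ord !big_imset; try exact: top_ord_inj.
rewrite gaps_word big_map -/(index_iota 0 n.+2) big_mkord.
rewrite [RHS](bigID descent).
by congr (_ * _); apply: eq_big => j; rewrite inE ?top_ordE /gap -/(descent j);
  case: (descent j).
Qed.

End Statistics.

Theorem theorem4p4 (R : realType) (n : nat) (hn : (1 <= n)%N) :
  stable (Ctilde R n).
Proof.
case: n hn => // n _; right=> z z_gt0; apply/eqP.
(* Indices shift from 1-based to 0-based. Out of range [inord] still returns some ordinal, so every
   value of [y] is a value of [z] and lies in the upper half-plane. *)
pose y (d : bool) k :=
  z (if d then lshift n.+1 (inord k.-1) else rshift n.+1 (inord k.-1)).
suff -> : (map_mpoly (real_complex R) (Ctilde R n.+1)).@[z] = words_sum y n.+1.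
  by apply: words_sum_neq0 => d k; exact: z_gt0.
rewrite /words_sum -(perm_big _ (perm_word_words n.+1)) big_map big_enum /=.
rewrite [map_mpoly _ _]raddf_sum [LHS]raddf_sum /=; apply: eq_bigr => s _.
rewrite -prod_statistics [map_mpoly _ _]rmorphM [LHS]rmorphM /=.
rewrite ![map_mpoly _ _]rmorph_prod !rmorph_prod /=.
by congr (_ * _); apply: eq_bigr => i _;
  rewrite map_mpolyX mevalXU /y /= inord_val.
Qed.
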